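(* Assume the predator–prey parasite model described in the context, and suppose Assumptions (A) and (B) hold. Then for every $t>0$, \[ \frac{\mathrm{var}(Y_{t})}{\mathbb{E}(Y_{t})} \leq \frac{\mathbb{E}(\tilde{X}^{2}_{t})}{\mathbb{E}(\tilde{X}_{t})}, \] and \[ \frac{\mathrm{var}(Y_{t})}{\mathbb{E}(Y_{t})} \geq \frac{1}{\Psi(t)} \int^{t}_{0} \left(\frac{\mathbb{E}(\tilde{X}^{2}_{s})}{\mathbb{E}(\tilde{X}_{s})}\right) \psi(s)\, ds \geq \int^{\infty}_{0} \left(\frac{\mathrm{var}(X_{r})}{\mathbb{E}(X_{r})} + \mathbb{E}(X_{r}) \right) \left( \frac{1}{\Psi(t)} \int^{t}_{0} f_{\tilde{A}_{s}} (r)\, \psi(s)\, ds \right) dr. \]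
   Context: Model. The parasite burden of a prey aged $t\ge 0$ is $X_t$, where $(X_t)_{t\ge0}$ is a non-decreasing integer-valued stochastic process with $X_0=0$ (all moments used are assumed finite, and denominators positive). Prey ages in the prey population have probability density $f_A$ on $[0,\infty)$. A predator encounters random members of the prey population at the times of a non-homogeneous Poisson process with intensity $\phi:[0,\infty)\to[0,\infty)$; when a predator aged $t$ encounters a prey aged $u$, it consumes it with probability $p(u,t)\in[0,1]$. Hence the consumption times form a Poisson process with intensity $\psi(t)=\phi(t)\int_0^\infty p(u,t)f_A(u)\,du$; set $\Psi(t)=\int_0^t\psi(s)\,ds$. The age $\tilde A_t$ of a prey consumed by a predator aged $t$ has density $f_{\tilde A_t}(a)= p(a,t)f_A(a)/\int_0^\infty p(u,t)f_A(u)\,du$, and the parasite burden of such a consumed prey is $\tilde X_t = X_{\tilde A_t}$ (with $\tilde A_t$ independent of the process $X$). A consumed prey transfers all its parasites to the predator, and the contributions of different consumed prey are independent. Thus the predator's burden $Y_t$ at age $t$ (with $Y_0=0$) is the sum, over the consumption times $s\le t$, of independent copies of $\tilde X_s$; in particular $\mathbb{E}(Y_t)=\int_0^t\mathbb{E}(\tilde X_s)\psi(s)\,ds$ and $\mathrm{var}(Y_t)=\int_0^t \mathbb{E}(\tilde X_s^2)\psi(s)\,ds$. Likelihood ratio order: for random variables $U,V$ (both discrete or both continuous) with mass/density functions $p_U,p_V$, write $U\le_{lr}V$ if $p_V(w)/p_U(w)$ is non-decreasing in $w$ over the union of the supports of $U$ and $V$. Assumption (A): for all $0\le s\le t$, $X_s\le_{lr}X_t$.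 Assumption (B): for all $0\le s<t$, the ratio $p(u,t)/p(u,s)$ is a non-decreasing function of $u$. *)

(* Defs.v *)
From HB Require Import structures.
From mathcomp Require Import all_boot all_order all_algebra.
From mathcomp Require Import all_classical all_reals all_analysis.
Set Implicit Arguments.
Unset Strict Implicit.
Unset Printing Implicit Defensive.
Import Order.TTheory GRing.Theory Num.Theory.
Import numFieldNormedType.Exports.
Local Open Scope classical_set_scope.
Local Open Scope ring_scope.

Section model.
Variable R : realType.

Definition int0oo (f : R -> R) : R :=
  \int[@lebesgue_measure R]_(x in `[0%R, +oo[) f x.
Definition int0t (t : R) (f : R -> R) : R :=
  \int[@lebesgue_measure R]_(x in `[0%R, t]) f x.

(* Likelihood ratio order, literal ratio definition: the ratio pV/pU is
   taken in the extended reals (value +oo where pU = 0 < pV) and must be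
   non-decreasing over the union of the supports of U and V.            *)
Definition lr_ratio (pU pV : R) : \bar R :=
  if pU == 0 then +oo%E else (pV / pU)%:E.

Definition lr_le_nat (pU pV : nat -> R) : Prop :=
  forall w1 w2 : nat, (w1 <= w2)%N ->
    (pU w1 != 0) || (pV w1 != 0) -> (pU w2 != 0) || (pV w2 != 0) ->
    (lr_ratio (pU w1) (pV w1) <= lr_ratio (pU w2) (pV w2))%E.

Section process.
Context d (Omega : measurableType d) (P : probability Omega R).
Variable X : R -> Omega -> nat.

Definition pmfX (t : R) (k : nat) : R := fine (P (X t @^-1` [set k])).
Definition EX (t : R) : R := fine ('E_P[(fun w => (X t w)%:R : R)%R])%E.
Definition EX2 (t : R) : R := fine ('E_P[(fun w => ((X t w)%:R ^+ 2 : R))%R])%E.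
Definition varX (t : R) : R := fine ('V_P[(fun w => (X t w)%:R : R)%R])%E.
End process.

(* Predator side.  fA : prey age density, phi : encounter intensity,
   p u t : probability that a predator aged t consumes an encountered
   prey aged u.                                                        *)
Section predator.
Variables (fA phi : R -> R) (p : R -> R -> R).

Definition consum_norm (t : R) : R := int0oo (fun u => p u t * fA u).
Definition psi (t : R) : R := phi t * consum_norm t.
Definition Psi (t : R) : R := int0t t psi.
(* density of the age of a prey consumed by a predator aged t *)
Definition fAt (t a : R) : R := p a t * fA a / consum_norm t.

(* Moments of Xtilde_t = X_{Atilde_t} (Atilde_t independent of X):
   E(g(Xtilde_t)) = \int_0^oo E(g(X_a)) f_{Atilde_t}(a) da.  They are
   expressed through the moment functions m1 a = E(X_a), m2 a = E(X_a^2). *)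
Definition EXt (m1 : R -> R) (t : R) : R := int0oo (fun a => m1 a * fAt t a).
Definition EXt2 (m2 : R -> R) (t : R) : R := int0oo (fun a => m2 a * fAt t a).

(* Moments of the predator burden Y_t (formulas stated in the model). *)
Definition EY (m1 : R -> R) (t : R) : R := int0t t (fun s => EXt m1 s * psi s).
Definition varY (m2 : R -> R) (t : R) : R := int0t t (fun s => EXt2 m2 s * psi s).
End predator.

End model.

(* Main.v *)
Require Import Defs.
From HB Require Import structures.
From mathcomp Require Import all_boot all_order all_algebra.
From mathcomp Require Import all_classical all_reals all_analysis.
From mathcomp Require Import measurable_realfun ring lra.
Set Implicit Arguments.
Unset Strict Implicit.
Unset Printing Implicit Defensive.
Import Order.TTheory GRing.Theory Num.Theory.
Import numFieldNormedType.Exports.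
Local Open Scope classical_set_scope.
Local Open Scope ring_scope.

(** Everything rests on the composition inequality
      (int u g) (int v f) <= (int u f) (int v g),
    valid when [u x v y - u y v x] and [f x g y - f y g x] always have the same
    sign.  Write m1, m2 for the first two moments of X_a, q_s for the density of
    the age of a prey consumed at s, F1, F2 for the moments of the burden of
    such a prey, and psi for the consumption intensity.  Assumption (A) and the
    inequality on the counting measure make h = m2 / m1 nondecreasing; then (B)
    and the inequality with weights q_s, q_t make F1 and G = F2 / F1
    nondecreasing.  Hence F2 psi <= G(t) F1 psi on [0, t], which is the upper
    bound; Chebyshev's inequality for G and F1 under psi is the first lower
    bound; and Chebyshev's inequality for h and m1 under q_s gives
    int h q_s <= G(s), which Tonelli's theorem turns into the second. *)

Lemma le_integrable_EFin (d : measure_display) (T : measurableType d)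
    (R : realType) (mu : {measure set T -> \bar R}) (D : set T) (f g : T -> R) :
  measurable D -> measurable_fun D f ->
  (forall x, D x -> 0 <= f x <= g x) ->
  mu.-integrable D (EFin \o g) -> mu.-integrable D (EFin \o f).
Proof.
move=> mD mf fg; apply: le_integrable => //; first exact/measurable_EFinP.
move=> x Dx /=; have /andP[f0 lefg] := fg x Dx.
by rewrite lee_fin !ger0_norm // (le_trans f0).
Qed.

Lemma integrable_EFinZl (d : measure_display) (T : measurableType d)
    (R : realType) (mu : {measure set T -> \bar R}) (D : set T) (k : R)
    (f : T -> R) :
  measurable D -> mu.-integrable D (EFin \o f) ->
  mu.-integrable D (EFin \o (fun x => k * f x)).
Proof.
move=> mD fi; have -> : EFin \o (fun x => k * f x) = (fun x => k%:E * (EFin \o f) x)%E.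
  by apply/funext => x /=; rewrite EFinM.
exact: integrableZl.
Qed.

Lemma Rintegral_comb4 (d : measure_display) (T : measurableType d)
    (R : realType) (mu : {measure set T -> \bar R}) (D : set T)
    (a b c e : R) (f1 f2 f3 f4 : T -> R) :
  measurable D ->
  mu.-integrable D (EFin \o f1) -> mu.-integrable D (EFin \o f2) ->
  mu.-integrable D (EFin \o f3) -> mu.-integrable D (EFin \o f4) ->
  \int[mu]_(x in D) ((a * f1 x - b * f2 x) - (c * f3 x - e * f4 x)) =
  (a * \int[mu]_(x in D) f1 x - b * \int[mu]_(x in D) f2 x) -
  (c * \int[mu]_(x in D) f3 x - e * \int[mu]_(x in D) f4 x).
Proof.
move=> mD i1 i2 i3 i4.
have iZ k f : mu.-integrable D (EFin \o f) ->
    mu.-integrable D (EFin \o (fun x => k * f x)) by exact: integrable_EFinZl.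
have iB k l f g : mu.-integrable D (EFin \o f) -> mu.-integrable D (EFin \o g) ->
    mu.-integrable D (EFin \o (fun x => k * f x - l * g x)).
  move=> fi gi; exact: (integrableB mD (iZ k _ fi) (iZ l _ gi)).
by rewrite !RintegralB ?RintegralZl //; auto.
Qed.

(* For fixed [x], the integral in [y] of the sign hypothesis is a linear
   combination of the four integrals; integrating it in [x] gives twice the
   claim, so no product measure is needed. *)
Lemma Rintegral_composition (d : measure_display) (T : measurableType d)
    (R : realType) (mu : {measure set T -> \bar R}) (D : set T)
    (u v f g : T -> R) :
  measurable D ->
  mu.-integrable D (EFin \o (fun x => u x * f x)) ->
  mu.-integrable D (EFin \o (fun x => v x * f x)) ->
  mu.-integrable D (EFin \o (fun x => u x * g x)) ->
  mu.-integrable D (EFin \o (fun x => v x * g x)) ->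
  (forall x y, D x -> D y ->
     0 <= (u x * v y - u y * v x) * (f x * g y - f y * g x)) ->
  (\int[mu]_(x in D) (u x * g x)) * (\int[mu]_(x in D) (v x * f x)) <=
  (\int[mu]_(x in D) (u x * f x)) * (\int[mu]_(x in D) (v x * g x)).
Proof.
move=> mD iuf ivf iug ivg uvfg.
set Iuf := \int[mu]_(x in D) (u x * f x).
set Ivf := \int[mu]_(x in D) (v x * f x).
set Iug := \int[mu]_(x in D) (u x * g x).
set Ivg := \int[mu]_(x in D) (v x * g x).
have inner x : D x -> 0 <= (Ivg * (u x * f x) - Ivf * (u x * g x)) -
    (Iug * (v x * f x) - Iuf * (v x * g x)).
  move=> Dx.
  suff -> : (Ivg * (u x * f x) - Ivf * (u x * g x)) -
      (Iug * (v x * f x) - Iuf * (v x * g x)) =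
      \int[mu]_(y in D) ((u x * v y - u y * v x) * (f x * g y - f y * g x)).
    by apply: Rintegral_ge0 => y Dy; exact: uvfg.
  rewrite (mulrC Ivg) (mulrC Ivf) (mulrC Iug) (mulrC Iuf) -Rintegral_comb4 //.
  by apply: eq_Rintegral => y _; ring.
have : 0 <= \int[mu]_(x in D) ((Ivg * (u x * f x) - Ivf * (u x * g x)) -
    (Iug * (v x * f x) - Iuf * (v x * g x))) by exact: Rintegral_ge0.
by rewrite Rintegral_comb4 // -/Iuf -/Ivf -/Iug -/Ivg; lra.
Qed.

Lemma lr_ratio_le_cross (R : realType) (a b c e : R) :
  0 <= a -> 0 <= b -> 0 <= c -> 0 <= e ->
  ((a != 0) || (b != 0) -> (c != 0) || (e != 0) ->
     (lr_ratio a b <= lr_ratio c e)%E) ->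
  c * b <= a * e.
Proof.
move=> a0 b0 c0 e0; rewrite /lr_ratio.
have [->|bn0] := eqVneq b 0; first by rewrite mulr0 mulr_ge0.
have [->|cn0] := eqVneq c 0; first by rewrite mul0r mulr_ge0.
rewrite orbT => /(_ isT isT); have [//|an0] := eqVneq a 0.
have ap : 0 < a by rewrite lt_neqAle eq_sym an0.
have cp : 0 < c by rewrite lt_neqAle eq_sym cn0.
by rewrite lee_fin ler_pdivrMr // mulrAC ler_pdivlMr // mulrC (mulrC a).
Qed.

Lemma nondecreasing_measurable0y (R : realType) (f : R -> R) :
  (forall x y, 0 <= x -> x <= y -> f x <= f y) ->
  measurable_fun (`[0%R, +oo[ : set R) f.
Proof.
move=> ndf; apply: (eq_measurable_fun (f \o Num.max 0)).
  by move=> x; rewrite inE /= in_itv /= andbT => x0; rewrite max_r.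
apply: nondecreasing_measurable => // x y xy.
apply: ndf; first by rewrite le_max lexx.
by rewrite ge_max !le_max lexx xy /= orbT.
Qed.

Section tonelli_on.
Context (d1 d2 : measure_display) (T1 : measurableType d1)
  (T2 : measurableType d2) (R : realType).
Variables (mu1 : {sigma_finite_measure set T1 -> \bar R})
  (mu2 : {sigma_finite_measure set T2 -> \bar R}).
Variables (D : set T1) (E : set T2) (k : T1 * T2 -> R).
Hypotheses (mD : measurable D) (mE : measurable E).
Hypothesis mk : measurable_fun (D `*` E) k.
Hypothesis k0 : forall x y, D x -> E y -> 0 <= k (x, y).

Let kE (z : T1 * T2) : \bar R := ((EFin \o k) \_ (D `*` E)) z.

Let mkE : measurable_fun setT kE.
Proof.
apply/(measurable_restrictT _ _).1; first exact: measurableX.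
exact/measurable_EFinP.
Qed.

Let kE_ge0 z : (0 <= kE z)%E.
Proof.
rewrite /kE patchE; case: ifPn => //; rewrite inE => -[Dz Ez].
by case: z Dz Ez => x y /= Dx Ey; rewrite lee_fin k0.
Qed.

Let inner1 x : ((fun x => \int[mu2]_(y in E) (k (x, y))%:E)%E \_ D) x =
  (\int[mu2]_y kE (x, y))%E.
Proof.
rewrite patchE; case: ifPn => Dx.
  rewrite integral_mkcond; apply: eq_integral => y _.
  by rewrite /kE !patchE in_setX Dx.
by rewrite integral0_eq// => y _; rewrite /kE patchE in_setX (negbTE Dx).
Qed.

Let inner2 y : ((fun y => \int[mu1]_(x in D) (k (x, y))%:E)%E \_ E) y =
  (\int[mu1]_x kE (x, y))%E.
Proof.
rewrite patchE; case: ifPn => Ey.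
  rewrite integral_mkcond; apply: eq_integral => x _.
  by rewrite /kE !patchE in_setX Ey andbT.
by rewrite integral0_eq// => x _; rewrite /kE patchE in_setX (negbTE Ey) andbF.
Qed.

Lemma tonelli_on :
  (\int[mu1]_(x in D) \int[mu2]_(y in E) (k (x, y))%:E =
   \int[mu2]_(y in E) \int[mu1]_(x in D) (k (x, y))%:E)%E.
Proof.
rewrite [LHS]integral_mkcond [RHS]integral_mkcond.
under eq_integral do rewrite inner1.
under [RHS]eq_integral do rewrite inner2.
exact: fubini_tonelli.
Qed.

Lemma measurable_tonelli_on2 :
  measurable_fun E (fun y => \int[mu1]_(x in D) (k (x, y))%:E)%E.
Proof.
apply/(measurable_restrictT _ mE).
rewrite (_ : _ \_ _ = fubini_G mu1 kE); last by apply/funext => y; exact: inner2.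
exact: measurable_fun_fubini_tonelli_G.
Qed.

End tonelli_on.

Section nat_valued.
Context (d : measure_display) (Omega : measurableType d) (R : realType)
  (P : probability Omega R).
Implicit Type Y : Omega -> nat.

Lemma measurable_fun_nat Y (g : nat -> R) :
  (forall k, measurable (Y @^-1` [set k])) ->
  measurable_fun setT (fun w => g (Y w)).
Proof.
move=> mY _ B _; rewrite setTI.
rewrite (_ : _ @^-1` _ = \bigcup_(k in g @^-1` B) (Y @^-1` [set k])).
  by apply: bigcup_measurable => k _; exact: mY.
by apply/seteqP; split => [w Bw|w [k Bk /= ->]] //; exists (Y w).
Qed.

Lemma integral_nat_valued Y (g : nat -> R) :
  (forall k, measurable (Y @^-1` [set k])) -> (forall k, 0 <= g k) ->
  (\int[P]_w (g (Y w))%:E =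
   \int[counting]_k (g k * fine (P (Y @^-1` [set k])))%:E)%E.
Proof.
move=> mY g0.
rewrite ge0_integral_count; last first.
  by move=> k; rewrite lee_fin mulr_ge0 // fine_ge0.
have UY : \bigcup_k (Y @^-1` [set k]) = setT.
  by apply/seteqP; split => // w _; exists (Y w).
rewrite -{1}UY ge0_integral_bigcup //.
- apply: eq_eseriesr => k _.
  under eq_integral => w do rewrite inE => /= ->.
  by rewrite integral_cst // EFinM fineK // fin_num_measure.
- by rewrite UY; exact/measurable_EFinP/measurable_fun_nat.
- by move=> w _; rewrite lee_fin.
- apply/trivIsetP => i j _ _ /eqP ij; apply/seteqP; split => // w [/= Yi Yj].
  by apply: ij; rewrite -Yi -Yj.
Qed.

Lemma integrable_nat_valued Y (g : nat -> R) :
  (forall k, measurable (Y @^-1` [set k])) -> (forall k, 0 <= g k) ->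
  P.-integrable setT (EFin \o (fun w => g (Y w))) ->
  counting.-integrable setT
    (EFin \o (fun k => g k * fine (P (Y @^-1` [set k])))).
Proof.
move=> mY g0 /integrableP[_ gY]; apply/integrableP; split => //.
under eq_integral => k _ do
  rewrite gee0_abs /= ?lee_fin ?mulr_ge0 ?fine_ge0 //.
rewrite -integral_nat_valued //.
by under eq_integral => w _ do rewrite -[(g _)%:E]gee0_abs ?lee_fin //.
Qed.

End nat_valued.

Section prey_moments.
Context (d : measure_display) (Omega : measurableType d) (R : realType)
  (P : probability Omega R) (X : R -> Omega -> nat).
Hypothesis hX_meas :
  forall (t : R) (k : nat), 0 <= t -> measurable (X t @^-1` [set k]).
Hypothesis hX2_fin : forall t : R, 0 <= t ->
  P.-integrable setT (EFin \o (fun w => ((X t w)%:R ^+ 2 : R))).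

Let natr_le_sqr (n : nat) : n%:R <= n%:R ^+ 2 :> R.
Proof. by rewrite -natrX ler_nat; case: n => // n; rewrite leq_pmulr. Qed.

Lemma integrable_prey t : 0 <= t ->
  P.-integrable setT (EFin \o (fun w => (X t w)%:R : R)).
Proof.
move=> t0; apply: le_integrable_EFin (hX2_fin t0) => //.
  by apply: (measurable_fun_nat (fun k => k%:R)) => k; exact: hX_meas.
by move=> w _; rewrite ler0n natr_le_sqr.
Qed.

Lemma EX_Rintegral t : EX P X t = \int[P]_w (X t w)%:R.
Proof. by rewrite /EX unlock. Qed.

Lemma EX2_Rintegral t : EX2 P X t = \int[P]_w ((X t w)%:R ^+ 2).
Proof. by rewrite /EX2 unlock. Qed.

Lemma EX_le_EX2 t : 0 <= t -> EX P X t <= EX2 P X t.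
Proof.
move=> t0; rewrite EX_Rintegral EX2_Rintegral.
by apply: le_Rintegral => //; [exact: integrable_prey|exact: hX2_fin].
Qed.

Lemma varX_EX2 t : 0 <= t -> varX P X t = EX2 P X t - EX P X t ^+ 2.
Proof.
move=> t0; have i1 := integrable_prey t0; have i2 := hX2_fin t0.
have XX : (fun w => (X t w)%:R : R) * (fun w => (X t w)%:R) =
    (fun w => (X t w)%:R ^+ 2) by apply/funext => w; rewrite expr2.
rewrite /varX /variance covarianceE.
- rewrite XX fineB ?fineM ?expr2 //.
  + exact/expectation_fin_num/Lfun1_integrable.
  + exact/expectation_fin_num/Lfun1_integrable.
  + exact/expectation_fin_num/Lfun1_integrable.
  + by rewrite fin_numM //; exact/expectation_fin_num/Lfun1_integrable.
- exact/Lfun1_integrable.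
- exact/Lfun1_integrable.
- by rewrite XX; exact/Lfun1_integrable.
Qed.

Lemma EX_lr_cross s t : 0 <= s -> 0 <= t ->
  lr_le_nat (pmfX P X s) (pmfX P X t) ->
  EX2 P X s * EX P X t <= EX2 P X t * EX P X s.
Proof.
move=> s0 t0 st; rewrite !EX_Rintegral !EX2_Rintegral /Rintegral.
have mX r : 0 <= r -> forall k, measurable (X r @^-1` [set k]).
  by move=> r0 k; exact: hX_meas.
rewrite !(integral_nat_valued _ _ (g := fun k => k%:R)) //; try exact: mX.
rewrite !(integral_nat_valued _ _ (g := fun k => k%:R ^+ 2)) //; try exact: mX.
apply: Rintegral_composition => //.
- by apply: integrable_nat_valued; [exact: mX|..|exact: hX2_fin] => //.
- by apply: integrable_nat_valued; [exact: mX|..|exact: integrable_prey] => //.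
- by apply: integrable_nat_valued; [exact: mX|..|exact: hX2_fin] => //.
- by apply: integrable_nat_valued; [exact: mX|..|exact: integrable_prey] => //.
have pmf_ge0 r k : 0 <= pmfX P X r k by rewrite fine_ge0.
have cross j k : (j <= k)%N ->
    pmfX P X s k * pmfX P X t j <= pmfX P X s j * pmfX P X t k.
  by move=> jk; apply: lr_ratio_le_cross => //; exact: st.
have factor j k : j%:R ^+ 2 * k%:R - k%:R ^+ 2 * j%:R =
    j%:R * k%:R * (j%:R - k%:R) :> R by ring.
move=> j k _ _; rewrite -!/(pmfX P X _ _) factor.
have [jk|/ltnW jk] := leqP j k.
  rewrite -mulrNN mulr_ge0 // oppr_ge0.
    by rewrite mulr_ge0_le0 // ?mulr_ge0 // subr_le0 ler_nat.
  by rewrite subr_le0 mulrC [leRHS]mulrC cross.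
rewrite mulr_ge0 // ?mulr_ge0 // ?subr_ge0 ?ler_nat //.
by rewrite mulrC [leRHS]mulrC cross.
Qed.

Hypothesis hX_mono : forall (s t : R) (w : Omega),
  0 <= s -> s <= t -> (X s w <= X t w)%N.

Lemma EX_nondecreasing s t : 0 <= s -> s <= t -> EX P X s <= EX P X t.
Proof.
move=> s0 st; have t0 := le_trans s0 st; rewrite !EX_Rintegral.
apply: le_Rintegral => //; [exact: integrable_prey..|].
by move=> w _; rewrite ler_nat hX_mono.
Qed.

End prey_moments.

Lemma comonotone_cross_ge0 (R : realDomainType) (a b c e v w : R) :
  0 <= v -> 0 <= w -> (a <= b /\ c <= e) \/ (b <= a /\ e <= c) ->
  0 <= (a - b) * (c * v * w - e * w * v).
Proof.
move=> v0 w0 mono.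
have -> : (a - b) * (c * v * w - e * w * v) = (a - b) * (c - e) * (v * w) by ring.
apply: mulr_ge0; last exact: mulr_ge0.
case: mono => -[ab ce]; last by rewrite mulr_ge0 // subr_ge0.
by rewrite -mulrNN mulr_ge0 // oppr_ge0 subr_le0.
Qed.

Lemma Rintegral_chebyshev (d : measure_display) (T : measurableType d)
    (R : realType) (mu : {measure set T -> \bar R}) (D : set T)
    (u f g : T -> R) :
  measurable D ->
  mu.-integrable D (EFin \o f) -> mu.-integrable D (EFin \o g) ->
  mu.-integrable D (EFin \o (fun x => u x * f x)) ->
  mu.-integrable D (EFin \o (fun x => u x * g x)) ->
  (forall x y, D x -> D y -> 0 <= (u x - u y) * (f x * g y - f y * g x)) ->
  (\int[mu]_(x in D) (u x * g x)) * (\int[mu]_(x in D) f x) <=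
  (\int[mu]_(x in D) (u x * f x)) * (\int[mu]_(x in D) g x).
Proof.
move=> mD fi gi uf ug ufg.
have one k : (fun x : T => 1 * k x) = k :> (T -> R).
  by apply/funext => x; rewrite mul1r.
have := @Rintegral_composition _ _ _ mu D u (fun=> 1) f g mD uf _ ug.
rewrite !one => /(_ fi gi); apply => x y Dx Dy; rewrite !mulr1; exact: ufg.
Qed.

Lemma Rintegral_eq0_sub (d : measure_display) (T : measurableType d)
    (R : realType) (mu : {measure set T -> \bar R}) (D : set T)
    (f g : T -> R) :
  measurable D -> measurable_fun D f -> mu.-integrable D (EFin \o g) ->
  (forall x, D x -> 0 <= g x) -> (forall x, D x -> g x = 0 -> f x = 0) ->
  \int[mu]_(x in D) g x = 0 -> \int[mu]_(x in D) f x = 0.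
Proof.
move=> mD mf gi g0 gf0 Ig.
have [mg _] := integrableP _ _ _ gi.
have Ig0 : (\int[mu]_(x in D) `|(EFin \o g) x| = 0)%E.
  transitivity (\int[mu]_(x in D) (g x)%:E)%E.
    by apply: eq_integral => x /set_mem Dx; rewrite gee0_abs //= lee_fin g0.
  by rewrite -[LHS]fineK; [rewrite -/(Rintegral _ _ _) Ig|exact: integrable_fin_num].
have g_ae0 := (ae_eq_integral_abs mu mD mg).1 Ig0.
rewrite /Rintegral (ae_eq_integral (cst 0%E)) ?integral0 //.
  exact/measurable_EFinP.
by apply: filterS g_ae0 => x /= gx0 Dx; have [/(gf0 _ Dx) ->] := gx0 Dx.
Qed.

Lemma measurable_fun_fst_on (d1 d2 d3 : measure_display)
    (T1 : measurableType d1) (T2 : measurableType d2) (T3 : measurableType d3)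
    (D : set T1) (E : set T2) (f : T1 -> T3) :
  measurable D -> measurable_fun D f ->
  measurable_fun (D `*` E) (fun z => f z.1).
Proof.
move=> mD mf; apply: (measurable_comp (f := f) mD) => //.
  by move=> _ [z [Dz _] <-].
by apply: measurable_funTS; exact: measurable_fst.
Qed.

Lemma measurable_fun_snd_on (d1 d2 d3 : measure_display)
    (T1 : measurableType d1) (T2 : measurableType d2) (T3 : measurableType d3)
    (D : set T1) (E : set T2) (f : T2 -> T3) :
  measurable E -> measurable_fun E f ->
  measurable_fun (D `*` E) (fun z => f z.2).
Proof.
move=> mE mf; apply: (measurable_comp (f := f) mE) => //.
  by move=> _ [z [_ Ez] <-].
by apply: measurable_funTS; exact: measurable_snd.
Qed.

Section predator_bounds.
Context (R : realType) (fA phi : R -> R) (p : R -> R -> R) (m1 m2 : R -> R).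
Local Notation lam := (@lebesgue_measure R).
Local Notation D := (`[0%R, +oo[%classic : set R).
Local Notation N := (consum_norm fA p).
Local Notation q := (fAt fA p).
Local Notation w := (psi fA phi p).
Local Notation F1 := (EXt fA p m1).
Local Notation F2 := (EXt2 fA p m2).

Hypothesis fA_meas : measurable_fun D fA.
Hypothesis fA_ge0 : forall a : R, 0 <= a -> 0 <= fA a.
Hypothesis fA_1 : (\int[lam]_(a in D) (fA a)%:E = 1)%E.
Hypothesis phi_ge0 : forall t : R, 0 <= t -> 0 <= phi t.
Hypothesis phi_int : forall t : R, 0 <= t ->
  lam.-integrable `[0%R, t] (EFin \o phi).
Hypothesis p_meas : measurable_fun (D `*` D) (fun z : R * R => p z.1 z.2).
Hypothesis p01 : forall u t : R, 0 <= u -> 0 <= t -> 0 <= p u t <= 1.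
Hypothesis p_cross : forall s t x y : R, 0 <= s -> s <= t -> 0 <= x -> x <= y ->
  p y s * p x t <= p x s * p y t.
Hypothesis N_gt0 : forall t : R, 0 <= t -> 0 < N t.

Hypothesis m1_0 : m1 0 = 0.
Hypothesis m2_0 : m2 0 = 0.
Hypothesis m1_gt0 : forall a : R, 0 < a -> 0 < m1 a.
Hypothesis m1_le_m2 : forall a : R, 0 <= a -> m1 a <= m2 a.
Hypothesis m1_nd : forall x y : R, 0 <= x -> x <= y -> m1 x <= m1 y.
Hypothesis m_cross : forall x y : R, 0 <= x -> x <= y ->
  m2 x * m1 y <= m2 y * m1 x.
Hypothesis m2q_int : forall s : R, 0 <= s ->
  lam.-integrable D (EFin \o (fun a => m2 a * q s a)).
Hypothesis F2w_int : forall t : R, 0 <= t ->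
  lam.-integrable `[0%R, t] (EFin \o (fun s => F2 s * w s)).

Let mD : measurable D. Proof. exact: measurable_itv. Qed.

Let D_ge0 (x : R) : D x -> 0 <= x.
Proof. by rewrite /= in_itv /= andbT. Qed.

Let m1_ge0 a : 0 <= a -> 0 <= m1 a.
Proof. by rewrite le_eqVlt => /predU1P[<-|/m1_gt0/ltW//]; rewrite m1_0. Qed.

Let m2_ge0 a : 0 <= a -> 0 <= m2 a.
Proof. by move=> a0; rewrite (le_trans (m1_ge0 a0)) ?m1_le_m2. Qed.

Let p_ge0 u t : 0 <= u -> 0 <= t -> 0 <= p u t.
Proof. by move=> u0 t0; have /andP[] := p01 u0 t0. Qed.

Let fA_int : lam.-integrable D (EFin \o fA).
Proof.
apply/integrableP; split; first exact/measurable_EFinP.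
rewrite (_ : (\int[_]_(x in _) _ = 1)%E) ?ltry // -fA_1.
by apply: eq_integral => a /set_mem /D_ge0 a0; rewrite gee0_abs //= lee_fin fA_ge0.
Qed.

Let p_meas1 t : 0 <= t -> measurable_fun D (p ^~ t).
Proof.
move=> t0; apply: (measurable_comp (f := fun z : R * R => p z.1 z.2)
  (F := D `*` D) (g := fun a => (a, t))) => //.
- exact: measurableX.
- by move=> _ [a Da <-]; split => //=; rewrite in_itv /= t0.
- by apply: measurable_funTS; exact: pair2_measurable.
Qed.

Let p_meas2 u : 0 <= u -> measurable_fun D (p u).
Proof.
move=> u0; apply: (measurable_comp (f := fun z : R * R => p z.1 z.2)
  (F := D `*` D) (g := fun a => (u, a))) => //.
- exact: measurableX.
- by move=> _ [a Da <-]; split => //=; rewrite in_itv /= u0.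
- by apply: measurable_funTS; exact: pair1_measurable.
Qed.

Let pf_int t : 0 <= t -> lam.-integrable D (EFin \o (fun a => p a t * fA a)).
Proof.
move=> t0; apply: le_integrable_EFin fA_int => //.
  by apply: measurable_funM => //; exact: p_meas1.
move=> a /D_ge0 a0; have /andP[pa0 pa1] := p01 a0 t0.
by rewrite mulr_ge0 ?fA_ge0 //= ler_piMl ?fA_ge0.
Qed.

Let q_ge0 s a : 0 <= s -> 0 <= a -> 0 <= q s a.
Proof.
by move=> s0 a0; rewrite /fAt divr_ge0 ?mulr_ge0 ?fA_ge0 ?p_ge0 // ltW ?N_gt0.
Qed.

Let qE s : q s = fun a => (N s)^-1 * (p a s * fA a).
Proof. by apply/funext => a; rewrite /fAt mulrC. Qed.

Let q_int s : 0 <= s -> lam.-integrable D (EFin \o q s).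
Proof. by move=> s0; rewrite qE; apply: integrable_EFinZl => //; exact: pf_int. Qed.

Let q_meas s : 0 <= s -> measurable_fun D (q s).
Proof. by move=> /q_int /integrableP[/measurable_EFinP]. Qed.

Let q_1 s : 0 <= s -> \int[lam]_(a in D) q s a = 1.
Proof.
move=> s0; rewrite qE RintegralZl //; last exact: pf_int.
by rewrite -/(int0oo _) -/(N s) mulVf // gt_eqF ?N_gt0.
Qed.

Let m1_meas : measurable_fun D m1.
Proof. exact: nondecreasing_measurable0y. Qed.

Let m1q_int s : 0 <= s -> lam.-integrable D (EFin \o (fun a => m1 a * q s a)).
Proof.
move=> s0; apply: le_integrable_EFin (m2q_int s0) => //.
  by apply: measurable_funM => //; exact: q_meas.
by move=> a /D_ge0 a0; rewrite mulr_ge0 ?q_ge0 ?m1_ge0 //= ler_wpM2r ?q_ge0 ?m1_le_m2.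
Qed.

Let F1_le_F2 s : 0 <= s -> F1 s <= F2 s.
Proof.
move=> s0; apply: le_Rintegral => //; [exact: m1q_int|exact: m2q_int|].
by move=> a /D_ge0 a0; rewrite ler_wpM2r ?q_ge0 ?m1_le_m2.
Qed.

Let F1_gt0 s : 0 <= s -> 0 < F1 s.
Proof.
move=> s0; rewrite lt_neqAle eq_sym Rintegral_ge0 ?andbT; last first.
  by move=> a /D_ge0 a0; rewrite mulr_ge0 ?q_ge0 ?m1_ge0.
apply/eqP => F10.
have sub : (`]0%R, +oo[%classic : set R) `<=` D.
  by move=> a /=; rewrite !in_itv /= !andbT => /ltW.
have iS f : lam.-integrable D (EFin \o f) ->
    lam.-integrable (`]0%R, +oo[%classic : set R) (EFin \o f) by exact: integrableS.
suff Iq0 : \int[lam]_(a in `]0%R, +oo[%classic) q s a = 0.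
  move: (q_1 s0); rewrite -Rintegral_itv_obnd_cbnd; last exact/iS/q_int.
  by rewrite Iq0 => /esym /eqP; rewrite oner_eq0.
apply: (@Rintegral_eq0_sub _ _ _ lam _ (q s) (fun a => m1 a * q s a)) => //.
- by have /integrableP[/measurable_EFinP] := iS _ (q_int s0).
- exact/iS/m1q_int.
- by move=> a /sub /D_ge0 a0; rewrite mulr_ge0 ?q_ge0 ?m1_ge0.
- move=> a; rewrite /= in_itv /= andbT => a0 /eqP.
  by rewrite mulf_eq0 (gt_eqF (m1_gt0 a0)) => /eqP.
- by rewrite Rintegral_itv_obnd_cbnd //; exact/iS/m1q_int.
Qed.

Let q_cross s t x y : 0 <= s -> s <= t -> 0 <= x -> x <= y ->
  q s y * q t x <= q s x * q t y.
Proof.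
move=> s0 st x0 xy; have t0 := le_trans s0 st; have y0 := le_trans x0 xy.
have ? := N_gt0 s0; have ? := N_gt0 t0.
rewrite !qE; set a := (N s)^-1; set b := (N t)^-1.
have := p_cross s0 st x0 xy.
rewrite -subr_ge0 => /(mulr_ge0 _) h; rewrite -subr_ge0.
have -> : a * (p x s * fA x) * (b * (p y t * fA y)) -
    a * (p y s * fA y) * (b * (p x t * fA x)) =
    (a * b * (fA x * fA y)) * (p x s * p y t - p y s * p x t) by ring.
by apply: h; rewrite !mulr_ge0 ?fA_ge0 // invr_ge0 ltW.
Qed.

Lemma EXt_nondecreasing s t : 0 <= s -> s <= t -> F1 s <= F1 t.
Proof.
move=> s0 st; have t0 := le_trans s0 st.
have := @Rintegral_chebyshev _ _ _ lam D m1 (q t) (q s) mD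
  (q_int t0) (q_int s0) (m1q_int t0) (m1q_int s0).
rewrite !q_1 // !mulr1; apply => x y /D_ge0 x0 /D_ge0 y0.
have [xy|/ltW yx] := leP x y.
  rewrite -mulrNN mulr_ge0 // oppr_ge0 subr_le0 ?m1_nd //.
  by rewrite mulrC [leRHS]mulrC q_cross.
by rewrite mulr_ge0 // subr_ge0 ?m1_nd // mulrC [leRHS]mulrC q_cross.
Qed.

Lemma EXt_cross s t : 0 <= s -> s <= t -> F2 s * F1 t <= F2 t * F1 s.
Proof.
move=> s0 st; have t0 := le_trans s0 st.
apply: Rintegral_composition => //;
  [exact: m2q_int|exact: m1q_int|exact: m2q_int|exact: m1q_int|].
move=> x y /D_ge0 x0 /D_ge0 y0.
have [xy|/ltW yx] := leP x y.
  rewrite -mulrNN mulr_ge0 // oppr_ge0 subr_le0 ?m_cross //.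
  by rewrite mulrC [leRHS]mulrC q_cross.
by rewrite mulr_ge0 // subr_ge0 ?m_cross // mulrC [leRHS]mulrC q_cross.
Qed.

Let mI t : measurable (`[0%R, t]%classic : set R).
Proof. exact: measurable_itv. Qed.

Let RZl (A : set R) k (f : R -> R) : measurable A -> lam.-integrable A (EFin \o f) ->
  \int[lam]_(x in A) (k * f x) = k * \int[lam]_(x in A) f x.
Proof. exact: (@RintegralZl _ _ _ lam). Qed.

Let iZl (A : set R) k (f : R -> R) : measurable A -> lam.-integrable A (EFin \o f) ->
  lam.-integrable A (EFin \o (fun x => k * f x)).
Proof. exact: (@integrable_EFinZl _ _ _ lam). Qed.

Let G s := F2 s / F1 s.

Let G_nd s t : 0 <= s -> s <= t -> G s <= G t.
Proof.
move=> s0 st; have t0 := le_trans s0 st; rewrite /G.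
rewrite ler_pdivrMr ?F1_gt0 // mulrAC ler_pdivlMr ?F1_gt0 //.
exact: EXt_cross.
Qed.

Let GF1 s : 0 <= s -> G s * F1 s = F2 s.
Proof. by move=> s0; rewrite /G divfK // gt_eqF ?F1_gt0. Qed.

Let G_ge0 s : 0 <= s -> 0 <= G s.
Proof.
by move=> s0; rewrite divr_ge0 ?(le_trans _ (F1_le_F2 s0)) // ltW ?F1_gt0.
Qed.

Let itv_sub t : (`[0%R, t]%classic : set R) `<=` D.
Proof. by move=> s /=; rewrite !in_itv /= andbT => /andP[]. Qed.

Let itv_ge0 t (s : R) : (`[0%R, t]%classic : set R) s -> 0 <= s.
Proof. by move=> /itv_sub /D_ge0. Qed.

Let itv_le t (s : R) : (`[0%R, t]%classic : set R) s -> s <= t.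
Proof. by rewrite /= in_itv /= => /andP[]. Qed.

Let measurable_funI (f : R -> R) t : measurable_fun D f ->
  measurable_fun (`[0%R, t]%classic : set R) f.
Proof. by apply: measurable_funS => //; exact: itv_sub. Qed.

Let N_meas : measurable_fun D N.
Proof.
apply: (measurableT_comp (f := @fine R)); first exact: fine_measurable.
apply: (measurable_tonelli_on2 lam (k := fun z : R * R => p z.1 z.2 * fA z.1)) => //.
  by apply: measurable_funM => //; exact: measurable_fun_fst_on.
by move=> a s /D_ge0 a0 /D_ge0 s0 /=; rewrite mulr_ge0 ?p_ge0 ?fA_ge0.
Qed.

Let N_le1 s : 0 <= s -> N s <= 1.
Proof.
move=> s0; have -> : 1 = \int[lam]_(a in D) fA a by rewrite /Rintegral fA_1.
apply: le_Rintegral => //; first exact: pf_int.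
move=> a /D_ge0 a0; have /andP[_ pa1] := p01 a0 s0.
by rewrite ler_piMl ?fA_ge0.
Qed.

Let w_ge0 s : 0 <= s -> 0 <= w s.
Proof. by move=> s0; rewrite mulr_ge0 ?phi_ge0 // ltW ?N_gt0. Qed.

Let w_int t : 0 <= t -> lam.-integrable `[0%R, t] (EFin \o w).
Proof.
move=> t0; apply: le_integrable_EFin (phi_int t0) => //.
  apply: measurable_funM; last exact: measurable_funI.
  by have /integrableP[/measurable_EFinP] := phi_int t0.
move=> s /itv_ge0 s0; rewrite w_ge0 //= ler_piMr ?phi_ge0 //; exact: N_le1.
Qed.

Let w_meas t : 0 <= t -> measurable_fun (`[0%R, t]%classic : set R) w.
Proof. by move=> /w_int /integrableP[/measurable_EFinP]. Qed.

Let F1w_int t : 0 <= t ->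
  lam.-integrable `[0%R, t] (EFin \o (fun s => F1 s * w s)).
Proof.
move=> t0; apply: le_integrable_EFin (F2w_int t0) => //.
  apply: measurable_funM; last exact: w_meas.
  apply: measurable_funI; apply: nondecreasing_measurable0y => *.
  exact: EXt_nondecreasing.
move=> s /itv_ge0 s0.
by rewrite mulr_ge0 ?w_ge0 //= ?ler_wpM2r ?w_ge0 ?F1_le_F2 // ltW ?F1_gt0.
Qed.

Let Gw_int t : 0 <= t ->
  lam.-integrable `[0%R, t] (EFin \o (fun s => G s * w s)).
Proof.
move=> t0.
apply: le_integrable_EFin (iZl (G t) (mI t) (w_int t0)) => //.
  apply: measurable_funM; last exact: w_meas.
  by apply: measurable_funI; apply: nondecreasing_measurable0y => *; exact: G_nd.
move=> s sI; have s0 := itv_ge0 sI; have st := itv_le sI.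
by rewrite mulr_ge0 ?w_ge0 ?G_ge0 //= ler_wpM2r ?w_ge0 ?G_nd.
Qed.

Let EY_gt0 t : 0 <= t -> 0 < Psi fA phi p t -> 0 < EY fA phi p m1 t.
Proof.
move=> t0 Psi0; apply: (@lt_le_trans _ _ (F1 0 * Psi fA phi p t)).
  by rewrite mulr_gt0 ?F1_gt0.
rewrite -(RZl (F1 0) (mI t) (w_int t0)).
apply: le_Rintegral => //; [|exact: F1w_int|].
  by apply: integrable_EFinZl => //; exact: w_int.
by move=> s /itv_ge0 s0; rewrite ler_wpM2r ?w_ge0 ?EXt_nondecreasing.
Qed.

Lemma varY_EY_le t : 0 <= t -> 0 < Psi fA phi p t ->
  varY fA phi p m2 t / EY fA phi p m1 t <= F2 t / F1 t.
Proof.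
move=> t0 /(EY_gt0 t0) EY0; rewrite ler_pdivrMr //.
rewrite -(RZl (F2 t / F1 t) (mI t) (F1w_int t0)).
apply: le_Rintegral => //; [exact: F2w_int| |].
  by apply: integrable_EFinZl => //; exact: F1w_int.
move=> s sI; have s0 := itv_ge0 sI; have st := itv_le sI.
by rewrite mulrA ler_wpM2r ?w_ge0 // mulrAC ler_pdivlMr ?F1_gt0 // EXt_cross.
Qed.

Lemma varY_EY_ge t : 0 <= t -> 0 < Psi fA phi p t ->
  (Psi fA phi p t)^-1 * int0t t (fun s => F2 s / F1 s * w s) <=
  varY fA phi p m2 t / EY fA phi p m1 t.
Proof.
move=> t0 Psi0; have EY0 := EY_gt0 t0 Psi0.
rewrite mulrC ler_pdivrMr // mulrAC ler_pdivlMr //.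
have GF s : (`[0%R, t]%classic : set R) s -> G s * (F1 s * w s) = F2 s * w s.
  by move=> /itv_ge0 s0; rewrite mulrA GF1.
have -> : varY fA phi p m2 t = \int[lam]_(s in `[0%R, t]) (G s * (F1 s * w s)).
  by apply: eq_Rintegral => s /set_mem /GF ->.
apply: (@Rintegral_chebyshev _ _ _ lam _ G (fun s => F1 s * w s) w) => //.
- exact: F1w_int.
- exact: w_int.
- apply: eq_integrable (F2w_int t0) => // s /set_mem /GF /= -> //.
- exact: Gw_int.
move=> x y /itv_ge0 x0 /itv_ge0 y0.
apply: comonotone_cross_ge0; [exact: w_ge0..|].
by have [xy|/ltW yx] := leP x y; [left|right]; rewrite ?G_nd ?EXt_nondecreasing.
Qed.

Let h r := m2 r / m1 r.

Let h_ge0 r : 0 <= r -> 0 <= h r.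
Proof. by move=> r0; rewrite divr_ge0 ?m1_ge0 ?m2_ge0. Qed.

Let h_nd x y : 0 <= x -> x <= y -> h x <= h y.
Proof.
rewrite le_eqVlt => /predU1P[<- y0|x0 xy]; first by rewrite {1}/h m2_0 mul0r h_ge0.
have y0 := lt_le_trans x0 xy.
rewrite /h ler_pdivrMr ?m1_gt0 // mulrAC ler_pdivlMr ?m1_gt0 //.
by rewrite m_cross // ltW.
Qed.

Let h_m1 r : 0 <= r -> h r * m1 r = m2 r.
Proof.
rewrite le_eqVlt => /predU1P[<-|r0]; first by rewrite m1_0 m2_0 mulr0.
by rewrite /h divfK // gt_eqF ?m1_gt0.
Qed.

Let h_meas : measurable_fun D h.
Proof. exact: nondecreasing_measurable0y. Qed.

(* [h <= h 1] on [0, 1], and [h <= m2 / m1 1] beyond. *)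
Let hq_int s : 0 <= s -> lam.-integrable D (EFin \o (fun r => h r * q s r)).
Proof.
move=> s0.
have i1 := iZl (h 1) mD (q_int s0).
have i2 := iZl (m1 1)^-1 mD (m2q_int s0).
have i12 : lam.-integrable D
    (EFin \o (fun r => h 1 * q s r + (m1 1)^-1 * (m2 r * q s r))).
  exact: (@integrableD _ _ _ lam D mD _ _ i1 i2).
apply: le_integrable_EFin i12 => //.
  by apply: measurable_funM => //; exact: q_meas.
move=> r /D_ge0 r0; rewrite mulr_ge0 ?h_ge0 ?q_ge0 //=.
rewrite (mulrA (m1 1)^-1) -mulrDl ler_wpM2r ?q_ge0 //.
have m11 : 0 < m1 1 by exact: m1_gt0.
have [r1|/ltW r1] := leP r 1.
  by rewrite -[leLHS]addr0 lerD ?h_nd // mulr_ge0 ?m2_ge0 // invr_ge0 ltW.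
rewrite -[leLHS]add0r lerD ?h_ge0 // /h (mulrC (m1 1)^-1) ler_wpM2l ?m2_ge0 //.
by rewrite lef_pV2 ?m1_nd // posrE (lt_le_trans m11) ?m1_nd.
Qed.

Let hq_le_G s : 0 <= s -> \int[lam]_(r in D) (h r * q s r) <= G s.
Proof.
move=> s0; rewrite ler_pdivlMr ?F1_gt0 //.
have hm r : D r -> h r * (m1 r * q s r) = m2 r * q s r.
  by move=> /D_ge0 r0; rewrite mulrA h_m1.
have -> : F2 s = \int[lam]_(r in D) (h r * (m1 r * q s r)) * \int[lam]_(r in D) q s r.
  rewrite q_1 // mulr1; apply: eq_Rintegral => r /set_mem /hm -> //.
apply: (@Rintegral_chebyshev _ _ _ lam _ h (fun r => m1 r * q s r) (q s)) => //.
- exact: m1q_int.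
- exact: q_int.
- by apply: eq_integrable (m2q_int s0) => // r /set_mem /hm /= ->.
- exact: hq_int.
move=> x y /D_ge0 x0 /D_ge0 y0.
apply: comonotone_cross_ge0; [exact: q_ge0..|].
by have [xy|/ltW yx] := leP x y; [left|right]; rewrite ?h_nd ?m1_nd.
Qed.

Lemma mixture_le_average t : 0 <= t -> 0 < Psi fA phi p t ->
  int0oo (fun r => m2 r / m1 r *
    ((Psi fA phi p t)^-1 * int0t t (fun s => q s r * w s))) <=
  (Psi fA phi p t)^-1 * int0t t (fun s => F2 s / F1 s * w s).
Proof.
move=> t0 Psi0; set c := (Psi fA phi p t)^-1.
have c0 : 0 <= c by rewrite invr_ge0 ltW.
pose K (z : R * R) := h z.1 * (c * (p z.1 z.2 * fA z.1 * phi z.2)).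
have phi_meas : measurable_fun (`[0%R, t]%classic : set R) phi.
  by have /integrableP[/measurable_EFinP] := phi_int t0.
have qw r s : 0 <= s -> q s r * w s = p r s * fA r * phi s.
  by move=> s0; rewrite /fAt /psi (mulrC (phi s)) mulrA divfK // gt_eqF ?N_gt0.
have pfphi_int r : 0 <= r -> lam.-integrable `[0%R, t]
    (EFin \o (fun s => p r s * fA r * phi s)).
  move=> r0.
  apply: le_integrable_EFin (iZl (fA r) (mI t) (phi_int t0)) => //.
    do 2 (apply: measurable_funM => //).
    by apply: measurable_funI; exact: p_meas2.
  move=> s /itv_ge0 s0; have /andP[? p1] := p01 r0 s0.
  by rewrite !mulr_ge0 ?fA_ge0 ?phi_ge0 //= ler_wpM2r ?phi_ge0 // ler_piMl ?fA_ge0.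
have inner r : D r -> (h r * (c * int0t t (fun s => q s r * w s)))%:E =
    (\int[lam]_(s in `[0%R, t]) (K (r, s))%:E)%E.
  move=> /D_ge0 r0.
  have -> : int0t t (fun s => q s r * w s) =
      \int[lam]_(s in `[0%R, t]) (p r s * fA r * phi s).
    by apply: eq_Rintegral => s /set_mem /itv_ge0 /qw ->.
  have i1 := iZl c (mI t) (pfphi_int r r0).
  have i2 := iZl (h r) (mI t) i1.
  rewrite -(RZl c (mI t) (pfphi_int r r0)).
  rewrite -(RZl (h r) (mI t) i1) fineK //.
  exact: integrable_fin_num.
have K_ge0 r s : D r -> (`[0%R, t]%classic : set R) s -> 0 <= K (r, s).
  move=> /D_ge0 r0 /itv_ge0 s0.
  apply: mulr_ge0; first exact: h_ge0.
  by rewrite !mulr_ge0 ?p_ge0 ?fA_ge0 ?phi_ge0.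
have K_meas : measurable_fun (D `*` (`[0%R, t]%classic : set R)) K.
  rewrite /K; apply: measurable_funM; first by apply: measurable_fun_fst_on.
  apply: measurable_funM => //; apply: measurable_funM.
    apply: measurable_funM; last exact: measurable_fun_fst_on.
    apply: measurable_funS p_meas; first exact: measurableX.
    by move=> z [Dz /itv_sub Ez].
  exact: measurable_fun_snd_on.
have outer s : (`[0%R, t]%classic : set R) s ->
    (\int[lam]_(r in D) (K (r, s))%:E <= (c * (G s * w s))%:E)%E.
  move=> /itv_ge0 s0.
  have -> : (\int[lam]_(r in D) (K (r, s))%:E =
      (c * w s * \int[lam]_(r in D) (h r * q s r))%:E)%E.
    rewrite -(RZl (c * w s) mD (hq_int s0)).
    rewrite fineK; last first.
      apply: integrable_fin_num => //.
      by apply: integrable_EFinZl => //; exact: hq_int.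
    by apply: eq_integral => r _; rewrite /K /= -qw //; congr EFin; ring.
  rewrite lee_fin -mulrA ler_wpM2l // mulrC ler_wpM2r ?w_ge0 //.
  exact: hq_le_G.
have cGw_int := iZl c (mI t) (Gw_int t0).
have -> : int0oo (fun r => m2 r / m1 r * (c * int0t t (fun s => q s r * w s))) =
    fine (\int[lam]_(r in D) \int[lam]_(s in `[0%R, t]) (K (r, s))%:E)%E.
  by congr fine; apply: eq_integral => r /set_mem /inner.
rewrite tonelli_on //.
have le : (\int[lam]_(s in `[0%R, t]) \int[lam]_(r in D) (K (r, s))%:E <=
    \int[lam]_(s in `[0%R, t]) (c * (G s * w s))%:E)%E.
  apply: ge0_le_integral => //.
  - by move=> s Es; apply: integral_ge0 => r Dr; rewrite lee_fin K_ge0.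
  - exact: measurable_tonelli_on2.
  - by have /integrableP[] := cGw_int.
have fin := @integrable_fin_num _ _ _ lam _ (mI t) _ cGw_int.
rewrite -(RZl c (mI t) (Gw_int t0)).
apply: fine_le => //.
rewrite ge0_fin_numE; first by rewrite (le_lt_trans le) // ltey_eq fin.
apply: integral_ge0 => s Es; apply: integral_ge0 => r Dr.
by rewrite lee_fin K_ge0.
Qed.

End predator_bounds.

Theorem theorem1 (R : realType)
  (d : measure_display) (Omega : measurableType d) (P : probability Omega R)
  (X : R -> Omega -> nat) (fA phi : R -> R) (p : R -> R -> R)
  (* prey age density on [0, +oo) *)
  (hfA_meas : measurable_fun (`[0%R, +oo[ : set R) fA)
  (hfA_ge0 : forall a : R, 0 <= a -> 0 <= fA a)
  (hfA_1 : (\int[@lebesgue_measure R]_(a in `[0%R, +oo[) (fA a)%:E = 1)%E)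
  (* encounter intensity *)
  (hphi_meas : measurable_fun (`[0%R, +oo[ : set R) phi)
  (hphi_ge0 : forall t : R, 0 <= t -> 0 <= phi t)
  (hphi_int : forall t : R, 0 <= t ->
     (@lebesgue_measure R).-integrable `[0%R, t] (EFin \o phi))
  (* consumption probabilities *)
  (hp_meas : measurable_fun ((`[0%R, +oo[ : set R) `*` (`[0%R, +oo[ : set R)) (fun z : R * R => p z.1 z.2))
  (hp01 : forall u t : R, 0 <= u -> 0 <= t -> 0 <= p u t <= 1)
  (* X : non-decreasing integer-valued process with X_0 = 0 *)
  (hX_meas : forall (t : R) (k : nat), 0 <= t -> measurable (X t @^-1` [set k]))
  (hX0 : forall w : Omega, X 0 w = 0%N)
  (hX_mono : forall (s t : R) (w : Omega), 0 <= s -> s <= t -> (X s w <= X t w)%N)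
  (* finiteness of the moments used *)
  (hX2_fin : forall t : R, 0 <= t ->
     P.-integrable setT (EFin \o (fun w => ((X t w)%:R ^+ 2 : R))))
  (hXt2_fin : forall s : R, 0 <= s ->
     (@lebesgue_measure R).-integrable `[0%R, +oo[
        (EFin \o (fun a => EX2 P X a * fAt fA p s a)))
  (hY2_fin : forall t : R, 0 <= t ->
     (@lebesgue_measure R).-integrable `[0%R, t]
        (EFin \o (fun s => EXt2 fA p (EX2 P X) s * psi fA phi p s)))
  (* positivity of denominators *)
  (hnorm_pos : forall t : R, 0 <= t -> 0 < consum_norm fA p t)
  (hEX_pos : forall a : R, 0 < a -> 0 < EX P X a)
  (* Assumption (A) *)
  (hA : forall s t : R, 0 <= s -> s <= t -> lr_le_nat (pmfX P X s) (pmfX P X t))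
  (* Assumption (B): u |-> p(u,t)/p(u,s) non-decreasing (ratio in the
     extended reals, over the union of the supports) *)
  (hB : forall s t : R, 0 <= s -> s < t ->
     forall u1 u2 : R, 0 <= u1 -> u1 <= u2 ->
       (p u1 s != 0) || (p u1 t != 0) -> (p u2 s != 0) || (p u2 t != 0) ->
       (lr_ratio (p u1 s) (p u1 t) <= lr_ratio (p u2 s) (p u2 t))%E) :
  forall t : R, 0 < t -> 0 < Psi fA phi p t ->
    varY fA phi p (EX2 P X) t / EY fA phi p (EX P X) t
      <= EXt2 fA p (EX2 P X) t / EXt fA p (EX P X) t
    /\
    (Psi fA phi p t)^-1 *
      int0t t (fun s => EXt2 fA p (EX2 P X) s / EXt fA p (EX P X) s
                          * psi fA phi p s)
      <= varY fA phi p (EX2 P X) t / EY fA phi p (EX P X) t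
    /\
    int0oo (fun r => (varX P X r / EX P X r + EX P X r) *
                     ((Psi fA phi p t)^-1 *
                        int0t t (fun s => fAt fA p s r * psi fA phi p s)))
      <= (Psi fA phi p t)^-1 *
           int0t t (fun s => EXt2 fA p (EX2 P X) s / EXt fA p (EX P X) s
                               * psi fA phi p s).
Proof.
have EX00 : EX P X 0 = 0.
  by rewrite EX_Rintegral (eq_Rintegral _ (g := fun=> 0)) ?Rintegral_cst ?mul0r //;
     move=> w _; rewrite hX0.
have EX20 : EX2 P X 0 = 0.
  by rewrite EX2_Rintegral (eq_Rintegral _ (g := fun=> 0)) ?Rintegral_cst ?mul0r //;
     move=> w _; rewrite hX0 expr0n.
have EX_nd := EX_nondecreasing hX_meas hX2_fin hX_mono.
have EX_cross x y : 0 <= x -> x <= y ->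
    EX2 P X x * EX P X y <= EX2 P X y * EX P X x.
  move=> x0 xy; apply: EX_lr_cross => //; first exact: le_trans xy.
  exact: hA.
have EX_le2 := EX_le_EX2 hX_meas hX2_fin.
have p_cross s t x y : 0 <= s -> s <= t -> 0 <= x -> x <= y ->
    p y s * p x t <= p x s * p y t.
  rewrite [s <= t]le_eqVlt => s0 /predU1P[<- _ _|st x0 xy]; first by rewrite mulrC.
  have t0 := ltW (le_lt_trans s0 st); have y0 := le_trans x0 xy.
  apply: lr_ratio_le_cross; last exact: hB.
  - by have /andP[] := hp01 _ _ x0 s0.
  - by have /andP[] := hp01 _ _ x0 t0.
  - by have /andP[] := hp01 _ _ y0 s0.
  - by have /andP[] := hp01 _ _ y0 t0.
move=> t /ltW t0 Psi0; split; [|split].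
- exact: varY_EY_le.
- exact: varY_EY_ge.
- have -> : int0oo (fun r => (varX P X r / EX P X r + EX P X r) *
      ((Psi fA phi p t)^-1 * int0t t (fun s => fAt fA p s r * psi fA phi p s))) =
    int0oo (fun r => EX2 P X r / EX P X r *
      ((Psi fA phi p t)^-1 * int0t t (fun s => fAt fA p s r * psi fA phi p s))).
    apply: eq_Rintegral => r /set_mem; rewrite /= in_itv /= andbT => r0.
    congr (_ * _); rewrite varX_EX2 //.
    have [->|EXn0] := eqVneq (EX P X r) 0; first by rewrite invr0 !mulr0 addr0.
    by rewrite expr2 mulrBl mulfK // subrK.
  exact: mixture_le_average.
Qed.
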